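(* For $\chi\in\{\epsilon,\operatorname{sgn}\}$, the induced module $I_\chi=\mathcal{A}_1\otimes_{\Bbbk\mathbb{S}_3}W_\chi$ is the projective cover of the $\mathcal{A}_1$-module $S_\chi$.
   Context: $\Bbbk$ is an algebraically closed field of characteristic zero. $\mathcal{A}_1$ is the 72-dimensional Hopf algebra generated as an algebra by $H_t$ ($t\in\mathbb{S}_3$) and $a_{12},a_{13},a_{23}$ (indexed by the transpositions of $\mathbb{S}_3$; $H_{12}=H_{(12)}$, etc.), with relations $H_e=1$, $H_tH_s=H_{ts}$; $H_ta_i=\operatorname{sgn}(t)a_{tit^{-1}}H_t$; $a_{12}^2=0$; $a_{12}a_{23}+a_{23}a_{13}+a_{13}a_{12}=1-H_{12}H_{23}$. $\Bbbk\mathbb{S}_3$ embeds in $\mathcal{A}_1$ via $t\mapsto H_t$. $W_\epsilon,W_{\operatorname{sgn}}$ are the trivial and sign representations of $\mathbb{S}_3$; $S_\chi$ is the one-dimensional $\mathcal{A}_1$-module where $H_t$ acts by $\chi(t)$ and all $a_i$ act by $0$. A projective cover of a module $M$ is a projective module $P$ with an essential surjection $f:P\to M$, i.e. $f(N)\neq M$ for every proper submodule $N\subset P$. *)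

(* Defs.v *)
From HB Require Import structures.
From mathcomp Require Import all_boot all_order all_algebra all_fingroup.
From mathcomp Require Import generic_quotient boolp.

Set Implicit Arguments.
Unset Strict Implicit.
Unset Printing Implicit Defensive.

Import GRing.Theory.
Local Open Scope ring_scope.
Local Open Scope quotient_scope.

Definition classical (T : Type) : Type := T.
HB.instance Definition _ T := gen_eqMixin (classical T).
HB.instance Definition _ T := gen_choiceMixin (classical T).

Section ProjectiveCover.
Variable A : pzRingType.

Definition surjective (X Y : Type) (f : X -> Y) : Prop :=
  forall y, exists x, f x = y.

Definition projective (P : lmodType A) : Prop :=
  forall (M N : lmodType A) (g : {linear M -> N}) (h : {linear P -> N}),
    surjective g -> exists h' : {linear P -> M}, forall x, g (h' x) = h x.

Definition essential (P M : lmodType A) (f : {linear P -> M}) : Prop :=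
  forall N : {pred P}, submod_closed N -> (exists x, x \notin N) ->
    ~ (forall m, exists2 x, x \in N & f x = m).

Definition projective_cover (P M : lmodType A) : Prop :=
  projective P /\
  exists f : {linear P -> M}, surjective f /\ essential f.

End ProjectiveCover.

Definition restrict (R S : pzRingType) (f : {rmorphism R -> S})
  (M : lmodType S) : Type := M.

Section Restrict.
Variables (R S : pzRingType) (f : {rmorphism R -> S}) (M : lmodType S).

HB.instance Definition _ := GRing.Zmodule.on (restrict f M).

Definition restrict_scale (r : R) (m : restrict f M) : restrict f M :=
  f r *: (m : M).

Fact restrict_scaleA a b v :
  restrict_scale a (restrict_scale b v) = restrict_scale (a * b) v.
Proof. by rewrite /restrict_scale rmorphM scalerA. Qed.
Fact restrict_scale1 : left_id 1 restrict_scale.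
Proof. by move=> v; rewrite /restrict_scale rmorph1 scale1r. Qed.
Fact restrict_scaleDr : right_distributive restrict_scale +%R.
Proof. by move=> a u v; rewrite /restrict_scale scalerDr. Qed.
Fact restrict_scaleDl v : {morph restrict_scale^~ v : a b / a + b}.
Proof. by move=> a b; rewrite /restrict_scale rmorphD scalerDl. Qed.

HB.instance Definition _ := GRing.Zmodule_isLmodule.Build R (restrict f M)
  restrict_scaleA restrict_scale1 restrict_scaleDr restrict_scaleDl.

End Restrict.

Section Induced.
Variables (R A : pzRingType) (f : {rmorphism R -> A}) (W : lmodType R).

Inductive tens_term :=
  | TPure of A & W
  | TZero
  | TAdd of tens_term & tens_term
  | TOpp of tens_term.

(* The least additive congruence for which TPure is biadditive and balanced;
   A is a right R-module through f. *)
Inductive tens_eq : tens_term -> tens_term -> Prop :=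
  | tens_refl u : tens_eq u u
  | tens_sym u v : tens_eq u v -> tens_eq v u
  | tens_trans u v w : tens_eq u v -> tens_eq v w -> tens_eq u w
  | tens_congD u u' v v' :
      tens_eq u u' -> tens_eq v v' -> tens_eq (TAdd u v) (TAdd u' v')
  | tens_congN u u' : tens_eq u u' -> tens_eq (TOpp u) (TOpp u')
  | tens_addA u v w : tens_eq (TAdd u (TAdd v w)) (TAdd (TAdd u v) w)
  | tens_addC u v : tens_eq (TAdd u v) (TAdd v u)
  | tens_add0 u : tens_eq (TAdd TZero u) u
  | tens_addN u : tens_eq (TAdd (TOpp u) u) TZero
  | tens_pureDl x y w :
      tens_eq (TPure (x + y) w) (TAdd (TPure x w) (TPure y w))
  | tens_pureDr x w w' :
      tens_eq (TPure x (w + w')) (TAdd (TPure x w) (TPure x w'))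
  | tens_bal x r w : tens_eq (TPure (x * f r) w) (TPure x (r *: w)).

Definition tens_rel (u v : classical tens_term) : bool := `[< tens_eq u v >].

Fact tens_rel_refl : reflexive tens_rel.
Proof. by move=> u; apply/asboolP; exact: tens_refl. Qed.
Fact tens_rel_sym : symmetric tens_rel.
Proof. by move=> u v; apply/asboolP/asboolP; exact: tens_sym. Qed.
Fact tens_rel_trans : transitive tens_rel.
Proof.
by move=> v u w /asboolP uv /asboolP vw; apply/asboolP; exact: tens_trans vw.
Qed.

Canonical tens_equiv := EquivRel tens_rel tens_rel_refl tens_rel_sym
  tens_rel_trans.

Definition induced : Type := {eq_quot tens_rel}.
HB.instance Definition _ := Choice.on induced.
HB.instance Definition _ := EqQuotient.on induced.

Lemma tens_piP (u v : classical tens_term) :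
  tens_eq u v <-> \pi_induced u = \pi_induced v.
Proof.
split=> [uv|/eqP]; first by apply/eqP; rewrite eqmodE; apply/asboolP.
by rewrite eqmodE => /asboolP.
Qed.

Lemma tens_reprP (u : classical tens_term) :
  tens_eq (repr (\pi_induced u)) u.
Proof. by apply/tens_piP; rewrite reprK. Qed.

Definition ind_add (x y : induced) : induced :=
  \pi_induced (TAdd (repr x) (repr y)).
Definition ind_opp (x : induced) : induced := \pi_induced (TOpp (repr x)).
Definition ind_zero : induced := \pi_induced TZero.

Lemma ind_addE (u v : classical tens_term) :
  ind_add (\pi_induced u) (\pi_induced v) = \pi_induced (TAdd u v).
Proof. by apply/tens_piP; apply: tens_congD; exact: tens_reprP. Qed.
Lemma ind_oppE (u : classical tens_term) :
  ind_opp (\pi_induced u) = \pi_induced (TOpp u).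
Proof. by apply/tens_piP; apply: tens_congN; exact: tens_reprP. Qed.

Lemma ind_ind (P : induced -> Prop) :
  (forall u : classical tens_term, P (\pi_induced u)) -> forall x, P x.
Proof. by move=> Pu x; rewrite -[x]reprK. Qed.

Fact ind_addA : associative ind_add.
Proof.
elim/ind_ind=> u; elim/ind_ind=> v; elim/ind_ind=> w.
by rewrite !ind_addE; apply/tens_piP; exact: tens_addA.
Qed.
Fact ind_addC : commutative ind_add.
Proof.
elim/ind_ind=> u; elim/ind_ind=> v.
by rewrite !ind_addE; apply/tens_piP; exact: tens_addC.
Qed.
Fact ind_add0 : left_id ind_zero ind_add.
Proof.
by elim/ind_ind=> u; rewrite ind_addE; apply/tens_piP; exact: tens_add0.
Qed.
Fact ind_addN : left_inverse ind_zero ind_opp ind_add.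
Proof.
elim/ind_ind=> u; rewrite ind_oppE ind_addE.
by apply/tens_piP; exact: tens_addN.
Qed.

HB.instance Definition _ :=
  GRing.isZmodule.Build induced ind_addA ind_addC ind_add0 ind_addN.

Fixpoint tens_act (b : A) (u : tens_term) : tens_term :=
  match u with
  | TPure x w => TPure (b * x) w
  | TZero => TZero
  | TAdd u v => TAdd (tens_act b u) (tens_act b v)
  | TOpp u => TOpp (tens_act b u)
  end.

Lemma tens_act_eq b u v : tens_eq u v -> tens_eq (tens_act b u) (tens_act b v).
Proof.
elim=> {u v} /=; try by constructor.
- by move=> u v w _ uv _; exact: tens_trans.
- by move=> x y w; rewrite mulrDr; constructor.
- by move=> x r w; rewrite mulrA; constructor.
Qed.

Definition ind_scale (b : A) (x : induced) : induced :=
  \pi_induced (tens_act b (repr x)).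

Lemma ind_scaleE b (u : classical tens_term) :
  ind_scale b (\pi_induced u) = \pi_induced (tens_act b u).
Proof. by apply/tens_piP; apply: tens_act_eq; exact: tens_reprP. Qed.

Lemma ind_piD (u v : classical tens_term) :
  \pi_induced (TAdd u v) = \pi_induced u + \pi_induced v.
Proof. by rewrite -ind_addE. Qed.
Lemma ind_piN (u : classical tens_term) :
  \pi_induced (TOpp u) = - \pi_induced u.
Proof. by rewrite -ind_oppE. Qed.
Lemma ind_pi0 : \pi_induced TZero = 0.
Proof. by []. Qed.

Fact ind_scaleA a b v : ind_scale a (ind_scale b v) = ind_scale (a * b) v.
Proof.
elim/ind_ind: v => u; rewrite !ind_scaleE; congr (\pi_induced _).
by elim: u => [x w||u IHu v IHv|u IHu] /=; rewrite ?mulrA ?IHu ?IHv.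
Qed.
Fact ind_scale1 : left_id 1 ind_scale.
Proof.
elim/ind_ind=> u; rewrite ind_scaleE; congr (\pi_induced _).
by elim: u => [x w||u IHu v IHv|u IHu] /=; rewrite ?mul1r ?IHu ?IHv.
Qed.
Fact ind_scaleDr : right_distributive ind_scale +%R.
Proof.
move=> a; elim/ind_ind=> u; elim/ind_ind=> v.
by rewrite -ind_piD !ind_scaleE -ind_piD.
Qed.
Fact ind_scaleDl v : {morph ind_scale^~ v : a b / a + b}.
Proof.
move=> a b; elim/ind_ind: v => u; rewrite !ind_scaleE.
elim: u => [x w||u IHu v IHv|u IHu] /=.
- by rewrite -ind_piD mulrDl; apply/tens_piP; constructor.
- by rewrite ind_pi0 addr0.
- by rewrite !ind_piD IHu IHv addrACA.
- by rewrite !ind_piN IHu opprD.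
Qed.

HB.instance Definition _ := GRing.Zmodule_isLmodule.Build A induced
  ind_scaleA ind_scale1 ind_scaleDr ind_scaleDl.

Definition tens (x : A) (w : W) : induced := \pi_induced (TPure x w).

Lemma tensDl x y w : tens (x + y) w = tens x w + tens y w.
Proof. by rewrite -ind_piD; apply/tens_piP; constructor. Qed.
Lemma tensDr x w w' : tens x (w + w') = tens x w + tens x w'.
Proof. by rewrite -ind_piD; apply/tens_piP; constructor. Qed.
Lemma tens_balanced x r w : tens (x * f r) w = tens x (r *: w).
Proof. by apply/tens_piP; constructor. Qed.
Lemma tensZ b x w : b *: tens x w = tens (b * x) w.
Proof. exact: ind_scaleE. Qed.

End Induced.

Definition group_algebra (k : comNzRingType) (gT : finGroupType) : Type :=
  {ffun gT -> k^o}.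

Section GroupAlgebra.
Variables (k : comNzRingType) (gT : finGroupType).
Local Notation kG := (group_algebra k gT).

HB.instance Definition _ := GRing.Lmodule.on kG.

Definition galg_coef (x : kG) (t : gT) : k := (x : {ffun gT -> k^o}) t.
Definition galg_of (t : gT) : kG := [ffun s => (s == t)%:R].
Definition galg_mul (x y : kG) : kG :=
  [ffun t => \sum_s galg_coef x s * galg_coef y (s^-1 * t)%g].

Lemma galg_coefM x y t :
  galg_coef (galg_mul x y) t =
  \sum_s galg_coef x s * galg_coef y (s^-1 * t)%g.
Proof. by rewrite /galg_coef ffunE. Qed.
Lemma galg_coefD x y t : galg_coef (x + y) t = galg_coef x t + galg_coef y t.
Proof. by rewrite /galg_coef ffunE. Qed.
Lemma galg_coefZ c x t : galg_coef (c *: x) t = c * galg_coef x t.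
Proof. by rewrite /galg_coef ffunE. Qed.
Lemma galg_coef_of s t : galg_coef (galg_of s) t = (t == s)%:R.
Proof. by rewrite /galg_coef ffunE. Qed.
Lemma galgP (x y : kG) : (forall t, galg_coef x t = galg_coef y t) -> x = y.
Proof. by move=> xy; apply/ffunP. Qed.

Fact galg_mulA : associative galg_mul.
Proof.
move=> x y z; apply: galgP => t; rewrite !galg_coefM.
under eq_bigr => s _ do rewrite galg_coefM big_distrr /=.
under [RHS]eq_bigr => s _ do rewrite galg_coefM big_distrl /=.
rewrite [RHS]exchange_big; apply: eq_bigr => s _.
rewrite [RHS](reindex_inj (mulgI s)) /=; apply: eq_bigr => r _.
by rewrite mulKg invMg -mulgA mulrA.
Qed.
Fact galg_mul1 : left_id (galg_of 1%g) galg_mul.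
Proof.
move=> x; apply: galgP => t; rewrite galg_coefM (bigD1 1%g) //= big1.
  by rewrite galg_coef_of eqxx mul1r addr0 invg1 mul1g.
by move=> s /negPf s1; rewrite galg_coef_of s1 mul0r.
Qed.
Fact galg_mulr1 : right_id (galg_of 1%g) galg_mul.
Proof.
move=> x; apply: galgP => t; rewrite galg_coefM (bigD1 t) //= big1.
  by rewrite galg_coef_of mulVg eqxx mulr1 addr0.
move=> s; rewrite eq_sym => st; rewrite galg_coef_of.
by rewrite -eq_mulVg1 eq_sym (negPf st) mulr0.
Qed.
Fact galg_mulDl : left_distributive galg_mul +%R.
Proof.
move=> x y z; apply: galgP => t; rewrite galg_coefD !galg_coefM -big_split /=.
by apply: eq_bigr => s _; rewrite galg_coefD mulrDl.
Qed.
Fact galg_mulDr : right_distributive galg_mul +%R.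
Proof.
move=> x y z; apply: galgP => t; rewrite galg_coefD !galg_coefM -big_split /=.
by apply: eq_bigr => s _; rewrite galg_coefD mulrDr.
Qed.
Fact galg_1neq0 : galg_of 1%g != 0.
Proof.
apply/eqP => /(congr1 (galg_coef^~ 1%g)); rewrite galg_coef_of eqxx.
by rewrite /galg_coef ffunE => /eqP; rewrite oner_eq0.
Qed.

HB.instance Definition _ := GRing.Zmodule_isNzRing.Build kG
  galg_mulA galg_mul1 galg_mulr1 galg_mulDl galg_mulDr galg_1neq0.

Fact galg_scalerAl (c : k) (x y : kG) : c *: (x * y) = (c *: x) * y.
Proof.
apply: galgP => t; rewrite galg_coefZ !galg_coefM big_distrr /=.
by apply: eq_bigr => s _; rewrite galg_coefZ mulrA.
Qed.
HB.instance Definition _ := GRing.Lmodule_isLalgebra.Build k kG galg_scalerAl.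

Fact galg_scalerAr (c : k) (x y : kG) : c *: (x * y) = x * (c *: y).
Proof.
apply: galgP => t; rewrite galg_coefZ !galg_coefM big_distrr /=.
by apply: eq_bigr => s _; rewrite galg_coefZ mulrCA.
Qed.
HB.instance Definition _ := GRing.Lalgebra_isAlgebra.Build k kG galg_scalerAr.

Section Lift.
Variables (B : algType k) (h : gT -> B).
Hypotheses (h1 : h 1%g = 1) (hM : forall s t, h s * h t = h (s * t)%g).

Definition galg_lift of h 1%g = 1 & (forall s t, h s * h t = h (s * t)%g) :=
  fun x : kG => \sum_t galg_coef x t *: h t.
Local Notation lift := (galg_lift h1 hM).

Fact galg_lift_linear : linear lift.
Proof.
move=> c x y; rewrite /galg_lift scaler_sumr -big_split /=.
by apply: eq_bigr => t _; rewrite galg_coefD galg_coefZ scalerDl scalerA.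
Qed.
HB.instance Definition _ := GRing.isLinear.Build k kG B *:%R lift
  galg_lift_linear.

Lemma galg_lift_of t : lift (galg_of t) = h t.
Proof.
rewrite /galg_lift (bigD1 t) //= big1 ?addr0.
  by rewrite galg_coef_of eqxx scale1r.
by move=> s /negPf st; rewrite galg_coef_of st scale0r.
Qed.

Fact galg_lift_monoid : monoid_morphism lift.
Proof.
split=> [|x y]; first by rewrite galg_lift_of.
rewrite /galg_lift mulr_suml.
under eq_bigr => t _ do rewrite galg_coefM scaler_suml.
rewrite exchange_big; apply: eq_bigr => s _ /=.
rewrite (reindex_inj (mulgI s)) /= mulr_sumr; apply: eq_bigr => t _.
by rewrite mulKg -scalerAl -scalerAr scalerA hM.
Qed.
HB.instance Definition _ := GRing.isMonoidMorphism.Build kG B lift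
  galg_lift_monoid.

End Lift.
End GroupAlgebra.

(* The product of 'S_3 is (s * t) x = t (s x), opposite to composition of maps.
   The definitions below only use the group law and the names of the
   transpositions, and t |-> t^-1 identifies the two groups fixing those. *)

Definition is_transposition (t : 'S_3) : bool :=
  [exists i, exists j, (i != j) && (t == tperm i j)].

Definition transposition : Type := {t : 'S_3 | is_transposition t}.

Fact tperm_transposition (i j : 'I_3) :
  i != j -> is_transposition (tperm i j).
Proof.
by move=> ij; apply/existsP; exists i; apply/existsP; exists j; rewrite ij eqxx.
Qed.

Fact conj_transposition (t : 'S_3) (i : transposition) :
  is_transposition (t * sval i * t^-1)%g.
Proof.
case: i => s /= /existsP[x /existsP[y /andP[xy /eqP->]]].
have -> : (t * tperm x y * t^-1)%g = tperm (t^-1 x)%g (t^-1 y)%g.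
  by rewrite -tpermJ conjgE invgK mulgA.
by apply: tperm_transposition; rewrite (inj_eq perm_inj).
Qed.

Definition conj_transp (t : 'S_3) (i : transposition) : transposition :=
  exist _ (t * sval i * t^-1)%g (conj_transposition t i).

Definition pt1 : 'I_3 := @Ordinal 3 0 isT.
Definition pt2 : 'I_3 := @Ordinal 3 1 isT.
Definition pt3 : 'I_3 := @Ordinal 3 2 isT.

Definition t12 : transposition :=
  exist _ (tperm pt1 pt2) (@tperm_transposition pt1 pt2 isT).
Definition t13 : transposition :=
  exist _ (tperm pt1 pt3) (@tperm_transposition pt1 pt3 isT).
Definition t23 : transposition :=
  exist _ (tperm pt2 pt3) (@tperm_transposition pt2 pt3 isT).

Definition sgn (k : pzRingType) (t : 'S_3) : k := (-1) ^+ odd_perm t.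

Inductive S3_char := Epsilon | Sgn.

Definition char_val (k : pzRingType) (chi : S3_char) (t : 'S_3) : k :=
  match chi with Epsilon => 1 | Sgn => sgn k t end.

Lemma char_val1 k chi : char_val k chi 1%g = 1.
Proof. by case: chi => //=; rewrite /sgn odd_perm1. Qed.

Lemma char_valM k chi s t :
  char_val k chi s * char_val k chi t = char_val k chi (s * t)%g.
Proof. by case: chi => /=; rewrite ?mulr1 // /sgn odd_permM signr_addb. Qed.

Record A1_rels (k : fieldType) (B : algType k)
    (H : 'S_3 -> B) (a : transposition -> B) : Prop := A1Rels {
  A1_rel_H1 : H 1%g = 1;
  A1_rel_HM : forall t s, H t * H s = H (t * s)%g;
  A1_rel_Ha : forall t i, H t * a i = sgn k t *: (a (conj_transp t i) * H t);
  A1_rel_aa : a t12 ^+ 2 = 0;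
  A1_rel_aaa : a t12 * a t23 + a t23 * a t13 + a t13 * a t12
               = 1 - H (sval t12) * H (sval t23) }.

Section A1.
Variable k : fieldType.

Inductive A1_term :=
  | AScal of k
  | AH of 'S_3
  | AA of transposition
  | AAdd of A1_term & A1_term
  | AMul of A1_term & A1_term.

Local Notation AOpp x := (AMul (AScal (-1)) x).

(* The congruence on terms generated by the axioms of unital associative
   k-algebras and the relations of A1_rels. *)
Inductive A1_eq : A1_term -> A1_term -> Prop :=
  | A1_refl x : A1_eq x x
  | A1_sym x y : A1_eq x y -> A1_eq y x
  | A1_trans x y z : A1_eq x y -> A1_eq y z -> A1_eq x z
  | A1_congD x x' y y' :
      A1_eq x x' -> A1_eq y y' -> A1_eq (AAdd x y) (AAdd x' y')
  | A1_congM x x' y y' :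
      A1_eq x x' -> A1_eq y y' -> A1_eq (AMul x y) (AMul x' y')
  | A1_addA x y z : A1_eq (AAdd x (AAdd y z)) (AAdd (AAdd x y) z)
  | A1_addC x y : A1_eq (AAdd x y) (AAdd y x)
  | A1_add0 x : A1_eq (AAdd (AScal 0) x) x
  | A1_addN x : A1_eq (AAdd (AOpp x) x) (AScal 0)
  | A1_mulA x y z : A1_eq (AMul x (AMul y z)) (AMul (AMul x y) z)
  | A1_mul1 x : A1_eq (AMul (AScal 1) x) x
  | A1_mulDl x y z : A1_eq (AMul (AAdd x y) z) (AAdd (AMul x z) (AMul y z))
  | A1_mulDr x y z : A1_eq (AMul x (AAdd y z)) (AAdd (AMul x y) (AMul x z))
  | A1_scalD c d : A1_eq (AScal (c + d)) (AAdd (AScal c) (AScal d))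
  | A1_scalM c d : A1_eq (AScal (c * d)) (AMul (AScal c) (AScal d))
  | A1_scalC c x : A1_eq (AMul (AScal c) x) (AMul x (AScal c))
  | A1_H1 : A1_eq (AH 1%g) (AScal 1)
  | A1_HM t s : A1_eq (AMul (AH t) (AH s)) (AH (t * s)%g)
  | A1_Ha t i :
      A1_eq (AMul (AH t) (AA i))
            (AMul (AScal (sgn k t)) (AMul (AA (conj_transp t i)) (AH t)))
  | A1_aa : A1_eq (AMul (AA t12) (AA t12)) (AScal 0)
  | A1_aaa :
      A1_eq (AAdd (AAdd (AMul (AA t12) (AA t23)) (AMul (AA t23) (AA t13)))
                  (AMul (AA t13) (AA t12)))
            (AAdd (AScal 1) (AOpp (AMul (AH (sval t12)) (AH (sval t23))))).

Definition A1_rel (x y : classical A1_term) : bool := `[< A1_eq x y >].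

Fact A1_rel_refl : reflexive A1_rel.
Proof. by move=> u; apply/asboolP; exact: A1_refl. Qed.
Fact A1_rel_sym : symmetric A1_rel.
Proof. by move=> u v; apply/asboolP/asboolP; exact: A1_sym. Qed.
Fact A1_rel_trans : transitive A1_rel.
Proof.
by move=> v u w /asboolP uv /asboolP vw; apply/asboolP; exact: A1_trans vw.
Qed.

Canonical A1_equiv := EquivRel A1_rel A1_rel_refl A1_rel_sym A1_rel_trans.

Definition A1 : Type := {eq_quot A1_rel}.
HB.instance Definition _ := Choice.on A1.
HB.instance Definition _ := EqQuotient.on A1.

Lemma A1_piP (u v : classical A1_term) :
  A1_eq u v <-> \pi_A1 u = \pi_A1 v.
Proof.
split=> [uv|/eqP]; first by apply/eqP; rewrite eqmodE; apply/asboolP.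
by rewrite eqmodE => /asboolP.
Qed.

Lemma A1_reprP (u : classical A1_term) : A1_eq (repr (\pi_A1 u)) u.
Proof. by apply/A1_piP; rewrite reprK. Qed.

Lemma A1_ind (P : A1 -> Prop) :
  (forall u : classical A1_term, P (\pi_A1 u)) -> forall x, P x.
Proof. by move=> Pu x; rewrite -[x]reprK. Qed.

Definition A1_add (x y : A1) : A1 := \pi_A1 (AAdd (repr x) (repr y)).
Definition A1_mul (x y : A1) : A1 := \pi_A1 (AMul (repr x) (repr y)).
Definition A1_scal (c : k) : A1 := \pi_A1 (AScal c).
Definition A1_opp (x : A1) : A1 := A1_mul (A1_scal (-1)) x.
Definition A1_scale (c : k) (x : A1) : A1 := A1_mul (A1_scal c) x.

Lemma A1_addE (u v : classical A1_term) :
  A1_add (\pi_A1 u) (\pi_A1 v) = \pi_A1 (AAdd u v).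
Proof. by apply/A1_piP; apply: A1_congD; exact: A1_reprP. Qed.
Lemma A1_mulE (u v : classical A1_term) :
  A1_mul (\pi_A1 u) (\pi_A1 v) = \pi_A1 (AMul u v).
Proof. by apply/A1_piP; apply: A1_congM; exact: A1_reprP. Qed.

Fact A1_add_assoc : associative A1_add.
Proof.
elim/A1_ind=> u; elim/A1_ind=> v; elim/A1_ind=> w.
by rewrite !A1_addE; apply/A1_piP; constructor.
Qed.
Fact A1_add_comm : commutative A1_add.
Proof.
elim/A1_ind=> u; elim/A1_ind=> v.
by rewrite !A1_addE; apply/A1_piP; constructor.
Qed.
Fact A1_add_0 : left_id (A1_scal 0) A1_add.
Proof. by elim/A1_ind=> u; rewrite A1_addE; apply/A1_piP; constructor. Qed.
Fact A1_add_N : left_inverse (A1_scal 0) A1_opp A1_add.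
Proof.
by elim/A1_ind=> u; rewrite /A1_opp A1_mulE A1_addE; apply/A1_piP; constructor.
Qed.

HB.instance Definition _ :=
  GRing.isZmodule.Build A1 A1_add_assoc A1_add_comm A1_add_0 A1_add_N.

Lemma A1_piD (u v : classical A1_term) :
  \pi_A1 (AAdd u v) = \pi_A1 u + \pi_A1 v.
Proof. by rewrite -A1_addE. Qed.

Fact A1_mul_assoc : associative A1_mul.
Proof.
elim/A1_ind=> u; elim/A1_ind=> v; elim/A1_ind=> w.
by rewrite !A1_mulE; apply/A1_piP; constructor.
Qed.
Fact A1_mul_1 : left_id (A1_scal 1) A1_mul.
Proof. by elim/A1_ind=> u; rewrite A1_mulE; apply/A1_piP; constructor. Qed.
Fact A1_scal_central c x : A1_mul (A1_scal c) x = A1_mul x (A1_scal c).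
Proof. by elim/A1_ind: x => u; rewrite !A1_mulE; apply/A1_piP; constructor. Qed.
Fact A1_mul_r1 : right_id (A1_scal 1) A1_mul.
Proof. by move=> x; rewrite -A1_scal_central A1_mul_1. Qed.
Fact A1_mul_Dl : left_distributive A1_mul +%R.
Proof.
elim/A1_ind=> u; elim/A1_ind=> v; elim/A1_ind=> w.
by rewrite -A1_piD !A1_mulE -A1_piD; apply/A1_piP; constructor.
Qed.
Fact A1_mul_Dr : right_distributive A1_mul +%R.
Proof.
elim/A1_ind=> u; elim/A1_ind=> v; elim/A1_ind=> w.
by rewrite -A1_piD !A1_mulE -A1_piD; apply/A1_piP; constructor.
Qed.

Section Eval.
Variables (B : algType k) (H : 'S_3 -> B) (a : transposition -> B).

Fixpoint A1_eval (u : A1_term) : B :=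
  match u with
  | AScal c => c%:A
  | AH t => H t
  | AA i => a i
  | AAdd u v => A1_eval u + A1_eval v
  | AMul u v => A1_eval u * A1_eval v
  end.

Hypothesis rels : A1_rels H a.

Lemma A1_eval_eq u v : A1_eq u v -> A1_eval u = A1_eval v.
Proof.
case: rels => rH1 rHM rHa raa raaa.
elim=> {u v} /=; rewrite ?scale0r ?scale1r ?scaleN1r //.
- by move=> x y z _ -> _ ->.
- by move=> x x' y y' _ -> _ ->.
- by move=> x x' y y' _ -> _ ->.
- by move=> *; rewrite addrA.
- by move=> *; rewrite addrC.
- by move=> *; rewrite add0r.
- by move=> x; rewrite mulN1r addNr.
- by move=> *; rewrite mulrA.
- by move=> *; rewrite mul1r.
- by move=> *; rewrite mulrDl.
- by move=> *; rewrite mulrDr.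
- by move=> *; rewrite scalerDl.
- by move=> c d; rewrite mulr_algl scalerA.
- by move=> c x; rewrite mulr_algl mulr_algr.
- by move=> t i; rewrite mulr_algl.
- by rewrite mulN1r.
Qed.

End Eval.

Lemma char_rels (chi : S3_char) :
  @A1_rels k k^o (char_val k chi) (fun=> 0).
Proof.
split=> [|t s|t i||].
- exact: char_val1.
- exact: char_valM.
- by rewrite mulr0 mul0r scaler0.
- by rewrite expr2 mulr0.
- rewrite !mulr0 !addr0 char_valM; case: chi => /=; first by rewrite subrr.
  by rewrite /sgn odd_permM !odd_tperm /= subrr.
Qed.

Fact A1_1neq0 : A1_scal 1 != 0.
Proof.
apply/eqP => /A1_piP /(A1_eval_eq (char_rels Epsilon)) /=.
by rewrite scale1r scale0r => /eqP; rewrite oner_eq0.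
Qed.

HB.instance Definition _ := GRing.Zmodule_isNzRing.Build A1
  A1_mul_assoc A1_mul_1 A1_mul_r1 A1_mul_Dl A1_mul_Dr A1_1neq0.

Lemma A1_piM (u v : classical A1_term) :
  \pi_A1 (AMul u v) = \pi_A1 u * \pi_A1 v.
Proof. by rewrite -A1_mulE. Qed.

Lemma A1_scalD_hom c d : A1_scal (c + d) = A1_scal c + A1_scal d.
Proof. by rewrite -A1_piD; apply/A1_piP; constructor. Qed.
Lemma A1_scalM_hom c d : A1_scal (c * d) = A1_scal c * A1_scal d.
Proof. by rewrite -A1_piM; apply/A1_piP; constructor. Qed.

Fact A1_scale_assoc c d x : A1_scale c (A1_scale d x) = A1_scale (c * d) x.
Proof. by rewrite /A1_scale A1_mul_assoc A1_scalM_hom. Qed.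
Fact A1_scale_1 : left_id 1 A1_scale.
Proof. exact: A1_mul_1. Qed.
Fact A1_scale_Dr : right_distributive A1_scale +%R.
Proof. by move=> c; exact: A1_mul_Dr. Qed.
Fact A1_scale_Dl x : {morph A1_scale^~ x : c d / c + d}.
Proof. by move=> c d; rewrite /A1_scale A1_scalD_hom A1_mul_Dl. Qed.

HB.instance Definition _ := GRing.Zmodule_isLmodule.Build k A1
  A1_scale_assoc A1_scale_1 A1_scale_Dr A1_scale_Dl.

Fact A1_scale_Al (c : k) (x y : A1) : c *: (x * y) = (c *: x) * y.
Proof. exact: A1_mul_assoc. Qed.
HB.instance Definition _ := GRing.Lmodule_isLalgebra.Build k A1 A1_scale_Al.

Fact A1_scale_Ar (c : k) (x y : A1) : c *: (x * y) = x * (c *: y).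
Proof.
change (A1_scal c * (x * y) = x * (A1_scal c * y)).
by rewrite mulrA [A1_scal c * x]A1_scal_central -mulrA.
Qed.
HB.instance Definition _ := GRing.Lalgebra_isAlgebra.Build k A1 A1_scale_Ar.

Definition A1_H (t : 'S_3) : A1 := \pi_A1 (AH t).
Definition A1_a (i : transposition) : A1 := \pi_A1 (AA i).

Lemma A1_relsP : A1_rels A1_H A1_a.
Proof.
have piN (u : classical A1_term) : \pi_A1 (AOpp u) = - \pi_A1 u.
  by rewrite A1_piM.
split=> [|t s|t i||].
- by apply/A1_piP; constructor.
- by rewrite -A1_piM; apply/A1_piP; constructor.
- by have /A1_piP := A1_Ha t i; rewrite !A1_piM.
- by rewrite expr2 -A1_piM; apply/A1_piP; constructor.
- by have /A1_piP := A1_aaa; rewrite !A1_piD piN !A1_piM.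
Qed.

Section Lift.
Variables (B : algType k) (H : 'S_3 -> B) (a : transposition -> B).
Hypothesis rels : A1_rels H a.

Definition A1_lift of A1_rels H a := fun x : A1 => A1_eval H a (repr x).
Local Notation lift := (A1_lift rels).

Lemma A1_liftE (u : classical A1_term) : lift (\pi_A1 u) = A1_eval H a u.
Proof. by apply: (A1_eval_eq rels); exact: A1_reprP. Qed.

Lemma A1_lift_H t : lift (A1_H t) = H t.
Proof. by rewrite A1_liftE. Qed.
Lemma A1_lift_a i : lift (A1_a i) = a i.
Proof. by rewrite A1_liftE. Qed.

Fact A1_lift_linear : linear lift.
Proof.
move=> c; elim/A1_ind=> u; elim/A1_ind=> v.
change (c *: \pi_A1 u) with (\pi_A1 (AScal c) * \pi_A1 u).
by rewrite -A1_piM -A1_piD !A1_liftE /= mulr_algl.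
Qed.
HB.instance Definition _ := GRing.isLinear.Build k A1 B *:%R lift
  A1_lift_linear.

Fact A1_lift_monoid : monoid_morphism lift.
Proof.
split=> [|]; first by rewrite A1_liftE /= scale1r.
by elim/A1_ind=> u; elim/A1_ind=> v; rewrite -A1_piM !A1_liftE.
Qed.
HB.instance Definition _ := GRing.isMonoidMorphism.Build A1 B lift
  A1_lift_monoid.

End Lift.

Local Notation kS3 := (group_algebra k 'S_3).

Definition kS3_to_A1 : {rmorphism kS3 -> A1} :=
  galg_lift (A1_rel_H1 A1_relsP) (A1_rel_HM A1_relsP).

Definition kS3_char (chi : S3_char) : {rmorphism kS3 -> k^o} :=
  @galg_lift k 'S_3 k^o (char_val k chi) (char_val1 k chi) (char_valM k chi).

(* By char_rels: H_t |-> chi t and a_i |-> 0. *)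
Definition A1_char (chi : S3_char) : {rmorphism A1 -> k^o} :=
  A1_lift (char_rels chi).

Definition W_ (chi : S3_char) : lmodType kS3 :=
  restrict (kS3_char chi) k^o.

Definition S_ (chi : S3_char) : lmodType A1 :=
  restrict (A1_char chi) k^o.

Definition I_ (chi : S3_char) : lmodType A1 := induced kS3_to_A1 (W_ chi).

End A1.

(* Main.v *)
(* Let e be the idempotent of k[S_3] attached to chi, so that I_chi is generated
   by the vector 1 (x) 1, which e fixes. Averaging with e shows that maps out of
   I_chi lift through surjections. For the essential surjection, the relations
   reduce every word in the a_i applied to e to the span of
   e, a_i e, a_i a_j e, a_i a_j a_i e and one element u = p e with
   p = (a12 a23 a12 - a12) a13; moreover every a_i kills u and S_3 acts on u by
   chi. Conjugating by S_3 shows e w e = 0 for the words w of length 1, 2, 3,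
   hence e r e = c e + d u for all r, where c is the value of the character at
   r. A submodule mapping onto S_chi contains some r (x) 1 with
   c = 1, so it contains (e + d u) (x) 1, and (1 - d p)(e + d u) = e. *)

Require Import Defs.
From HB Require Import structures.
From mathcomp Require Import all_boot all_order all_algebra all_fingroup.
From mathcomp Require Import generic_quotient.

Set Implicit Arguments.
Unset Strict Implicit.
Unset Printing Implicit Defensive.

Import GRing.Theory.
Local Open Scope ring_scope.

(** * The three transpositions and their conjugation *)

Lemma transpositionP (i : transposition) : [\/ i = t12, i = t13 | i = t23].
Proof.
have [x [y [xy iE]]] : exists x y, x != y /\ sval i = tperm x y.
  by have /existsP[x /existsP[y /andP[? /eqP ?]]] := svalP i; exists x, y.
have : [\/ sval i = tperm pt1 pt2, sval i = tperm pt1 pt3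
         | sval i = tperm pt2 pt3].
  rewrite iE; move: x y xy {iE} => [[|[|[|//]]] hx] [[|[|[|//]]] hy] //= _;
  rewrite ?(bool_irrelevance hx isT) ?(bool_irrelevance hy isT);
  by [apply: Or31|apply: Or32|apply: Or33|rewrite tpermC; apply: Or31
    |rewrite tpermC; apply: Or32|rewrite tpermC; apply: Or33].
by case=> e; [apply: Or31|apply: Or32|apply: Or33]; exact: val_inj.
Qed.

Lemma conj_transp_inj t : injective (conj_transp t).
Proof. by move=> i j /(congr1 sval) /= /mulIg /mulgI; exact: val_inj. Qed.

Lemma conj_transp_self (i : transposition) : conj_transp (sval i) i = i.
Proof. by apply: val_inj; rewrite /= mulgK. Qed.

Lemma transp_neq :
  (((t12 == t13 = false) * (t12 == t23 = false) * (t13 == t23 = false)) *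
  ((t13 == t12 = false) * (t23 == t12 = false) * (t23 == t13 = false)))%type.
Proof.
have neq (i j : transposition) p : sval i p != sval j p ->
    (i == j = false) * (j == i = false).
  by move=> ne; rewrite (eq_sym j); split; apply: contraNF ne => /eqP->.
have e1 : sval t12 pt1 != sval t13 pt1 by rewrite /= !permE.
have e2 : sval t12 pt1 != sval t23 pt1 by rewrite /= !permE.
have e3 : sval t13 pt1 != sval t23 pt1 by rewrite /= !permE.
by rewrite !(neq _ _ _ e1) !(neq _ _ _ e2) !(neq _ _ _ e3).
Qed.

(** With [conj_transp_self], this computes every conjugation between transpositions, so later
    arguments need only three distinct labels. *)
Lemma conj_transp_third i j l : uniq [:: i; j; l : transposition] ->
  conj_transp (sval i) j = l.
Proof.
case: (transpositionP i) => ->; case: (transpositionP j) => ->;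
  case: (transpositionP l) => ->;
  rewrite /= !inE ?eqxx ?transp_neq // => _; apply: val_inj; rewrite /= tpermV;
  apply/permP => -[[|[|[|//]]] h]; apply: val_inj;
  by rewrite /= !permE /= ?permE /= ?permE.
Qed.

Lemma transp_third (i j : transposition) : i != j ->
  exists l, uniq [:: i; j; l].
Proof.
case: (transpositionP i) => ->; case: (transpositionP j) => ->;
  rewrite ?eqxx // => _;
  [exists t23|exists t13|exists t23|exists t12|exists t13|exists t12];
  by rewrite /= !inE ?transp_neq.
Qed.

Lemma uniq_transp_cover (i j l m : transposition) : uniq [:: i; j; l] ->
  [\/ m = i, m = j | m = l].
Proof.
move=> ijl; suff : m \in [:: i; j; l].
  by rewrite !inE => /or3P[]/eqP; [apply: Or31|apply: Or32|apply: Or33].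
move: ijl; case: (transpositionP i) => ->; case: (transpositionP j) => ->;
  case: (transpositionP l) => ->; case: (transpositionP m) => ->;
  by rewrite /= !inE ?eqxx ?transp_neq ?orbT.
Qed.

Lemma uniq_rot3 (T : eqType) (i j l : T) :
  uniq [:: i; j; l] -> uniq [:: j; l; i].
Proof. by rewrite -(rot_uniq 1 [:: i; j; l]). Qed.

Lemma uniq_swap12 (T : eqType) (i j l : T) :
  uniq [:: i; j; l] -> uniq [:: j; i; l].
Proof. by rewrite /= !inE eq_sym; case: (j == i); case: (i == l). Qed.

Lemma uniq_swap23 (T : eqType) (i j l : T) :
  uniq [:: i; j; l] -> uniq [:: i; l; j].
Proof. by move=> /uniq_rot3 /uniq_swap12 /uniq_rot3 /uniq_rot3. Qed.

(** * Linear spans, set up for induction on generators *)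

Section LinSpan.
Variables (k : fieldType) (V : lmodType k) (G : V -> Prop).

Inductive lin_span : V -> Prop :=
  | Span0 : lin_span 0
  | SpanG x : G x -> lin_span x
  | SpanZD c x y : lin_span x -> lin_span y -> lin_span (c *: x + y).

Lemma lin_spanD x y : lin_span x -> lin_span y -> lin_span (x + y).
Proof. by move=> Gx Gy; rewrite -[x]scale1r; exact: SpanZD. Qed.

Lemma lin_spanZ c x : lin_span x -> lin_span (c *: x).
Proof.
by move=> Gx; rewrite -[_ *: _]addr0; apply: SpanZD => //; exact: Span0.
Qed.

Lemma lin_spanN x : lin_span x -> lin_span (- x).
Proof. by rewrite -scaleN1r; exact: lin_spanZ. Qed.

End LinSpan.

(** * Consequences of the defining relations in any algebra satisfying them *)

Section Relations.
Variables (k : fieldType) (B : algType k).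
Variables (H : 'S_3 -> B) (a : transposition -> B).
Hypothesis rels : A1_rels H a.
Local Notation s i := (H (sval i)).

Lemma sgnK t : sgn k t * sgn k t = 1.
Proof. by rewrite /sgn -expr2 sqrr_sign. Qed.

Lemma sgn_transp (i : transposition) : sgn k (sval i) = -1.
Proof.
by have /existsP[x /existsP[y /andP[xy /eqP->]]] := svalP i;
  rewrite /sgn odd_tperm xy.
Qed.

Lemma mulHV t : H t * H t^-1%g = 1.
Proof. by rewrite (A1_rel_HM rels) mulgV (A1_rel_H1 rels). Qed.

Lemma mul_Haa t i j :
  H t * (a i * a j) = a (conj_transp t i) * a (conj_transp t j) * H t.
Proof.
rewrite mulrA (A1_rel_Ha rels) -scalerAl -[_ * a j]mulrA (A1_rel_Ha rels).
by rewrite -scalerAr scalerA sgnK scale1r mulrA.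
Qed.

Lemma mul_sa (i j l : transposition) :
  uniq [:: i; j; l] -> s i * a j = - (a l * s i).
Proof.
move=> u; rewrite (A1_rel_Ha rels) sgn_transp scaleN1r.
by rewrite (conj_transp_third u).
Qed.

Lemma mul_saC i : s i * a i = - (a i * s i).
Proof. by rewrite (A1_rel_Ha rels) sgn_transp scaleN1r conj_transp_self. Qed.

(** Conjugating by [H t] carries the relation for [t12] to the other two transpositions: the sign
    enters twice and cancels. *)
Lemma mul_aa i : a i * a i = 0.
Proof.
have conj0 t j : a j * a j = 0 -> a (conj_transp t j) * a (conj_transp t j) = 0.
  by move=> j0; rewrite -[LHS]mulr1 -(mulHV t) mulrA -mul_Haa j0 mulr0 mul0r.
have a12 := A1_rel_aa rels; rewrite expr2 in a12.
case: (transpositionP i) => -> //.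
  rewrite -(@conj_transp_third t23 t12 t13) ?conj0 //.
  by rewrite /= !inE !transp_neq.
rewrite -(@conj_transp_third t13 t12 t23) ?conj0 //.
by rewrite /= !inE !transp_neq.
Qed.

Lemma mul_ss (i j l : transposition) :
  uniq [:: i; j; l] -> s i * s j = s l * s i.
Proof.
move=> u; rewrite !(A1_rel_HM rels); congr H.
by rewrite -(conj_transp_third u) /= mulgKV.
Qed.

Lemma mul_ss_a (i j l : transposition) :
  uniq [:: i; j; l] -> s i * s j * a i = a j * (s i * s j).
Proof.
move=> u; rewrite -mulrA (mul_sa (uniq_swap12 u)) mulrN (mulrA (s i)).
by rewrite (mul_sa (uniq_swap23 u)) mulNr opprK -mulrA.
Qed.

Lemma sum_aa (i j l : transposition) : uniq [:: i; j; l] ->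
  a i * a j + a j * a l + a l * a i = 1 - s i * s j.
Proof.
pose P i j l := a i * a j + a j * a l + a l * a i = 1 - s i * s j.
(* A cyclic shift permutes the summands and preserves the right side by [mul_ss]; conjugating by the
   first transposition ([flipP]) exchanges the other two. These moves reach all six labellings. *)
have rotP x y z : uniq [:: x; y; z] -> P x y z -> P y z x.
  move=> u Pxyz; rewrite /P addrC addrA Pxyz.
  by rewrite (mul_ss u) (mul_ss (uniq_rot3 (uniq_rot3 u))).
have u1 : uniq [:: t12; t23; t13] by rewrite /= !inE !transp_neq.
have P1 : P t12 t23 t13 := A1_rel_aaa rels.
have P2 := rotP _ _ _ u1 P1; have P3 := rotP _ _ _ (uniq_rot3 u1) P2.
have flipP x y z : uniq [:: x; y; z] -> P x y z -> P x z y.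
  move=> u Pxyz; have := congr1 (fun r => s x * r * H (sval x)^-1%g) Pxyz.
  rewrite !mulrDr !mul_Haa conj_transp_self (conj_transp_third u).
  rewrite (conj_transp_third (uniq_swap23 u)) -!mulrDl -mulrA mulHV mulr1 /P.
  move=> ->; rewrite mulrN mulr1 mulrBl mulHV mulrA; congr (_ - _).
  by rewrite !(A1_rel_HM rels) -(conj_transp_third u) /= !mulgA.
have Q1 := flipP _ _ _ u1 P1; have u2 := uniq_swap23 u1.
have Q2 := rotP _ _ _ u2 Q1; have Q3 := rotP _ _ _ (uniq_rot3 u2) Q2.
case: (transpositionP i) => ->; case: (transpositionP j) => ->;
  case: (transpositionP l) => ->; rewrite /= !inE ?eqxx ?transp_neq //.
Qed.

(** Multiply [sum_aa] by [a i] on the right and by [a j] on the left. Squares vanish, and both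
    results contain [a j * a l * a i] and [a j * (s i * s j)], which cancel in the difference. *)
Lemma mul_aba (i j : transposition) : i != j ->
  a i * a j * a i - a j * a i * a j = a i - a j.
Proof.
case/transp_third => l u; have R := sum_aa u.
have := congr1 (fun x => x * a i) R.
rewrite !mulrDl -[a l * a i * a i]mulrA mul_aa mulr0 addr0 mul1r mulNr.
rewrite (mul_ss_a u) => /(canRL (addrK _)) ->.
have := congr1 (fun x => a j * x) R.
rewrite !mulrDr [a j * (a j * _)]mulrA mul_aa mul0r addr0 mulr1 mulrN !mulrA.
move=> /(canRL (addrK _)) ->.
have subKK (p q r : B) : p - r - (q - r) = p - q.
  by rewrite opprB addrA subrK.
by rewrite !subKK.
Qed.

Lemma mul_abab (i j : transposition) :
  i != j -> a i * a j * a i * a j = a i * a j.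
Proof.
move=> /mul_aba /(canRL (subrK _)) ->.
by rewrite mulrDl mulrBl -[a j * a i * _ * _]mulrA mul_aa !mulr0 addr0 subr0.
Qed.

Lemma mul_Ha_l t i r :
  H t * (a i * r) = sgn k t *: (a (conj_transp t i) * (H t * r)).
Proof. by rewrite !mulrA (A1_rel_Ha rels) -scalerAl. Qed.

(** * Words in the [a i] applied to an eigenvector [e] of character [chi] *)

Section Eigen.
Variables (chi : S3_char) (e : B).
Local Notation X := (char_val k chi).
Hypothesis He : forall t, H t * e = X t *: e.

(** A product of two transpositions is even, so both characters are 1 on it. This makes the
    inhomogeneous relation [sum_aa] homogeneous on [e]. *)
Lemma mul_sse (i j : transposition) : s i * s j * e = e.
Proof.
rewrite (A1_rel_HM rels) He -char_valM; case: chi => /=.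
  by rewrite mulr1 scale1r.
by rewrite !sgn_transp mulrNN mulr1 scale1r.
Qed.

Lemma sum_aae (i j l : transposition) : uniq [:: i; j; l] ->
  a i * a j * e + a j * a l * e + a l * a i * e = 0.
Proof. by move=> u; rewrite -!mulrDl (sum_aa u) mulrBl mul1r mul_sse subrr. Qed.

(** Multiplying [sum_aae] on the left by [a i] kills its first summand. *)
Lemma mul_abce (i j l : transposition) : uniq [:: i; j; l] ->
  a i * a j * a l * e = - (a i * a l * a i * e).
Proof.
move=> u; apply/eqP; rewrite -addr_eq0.
have := congr1 (fun x => a i * x) (sum_aae u).
by rewrite !mulrDr !mulrA mul_aa !mul0r add0r mulr0 => ->.
Qed.

(** Sandwich [sum_aa] between [a i] and [a j * e]. Moving [s i * s j] past [a j] costs two signs and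
    turns [a j] into [a l]. *)
Lemma mul_abcbe (i j l : transposition) : uniq [:: i; j; l] ->
  a i * a l * a i * a j * e =
  a i * a j * e - a i * a l * e - a i * a j * a l * a j * e.
Proof.
move=> u; apply/(canRL (addrK _)).
have := congr1 (fun x => a i * (x * (a j * e))) (sum_aa u).
rewrite !mulrDl !mulrDr !mulrA mul_aa !mul0r add0r addrC => ->.
rewrite mulr1 mulrN !mulNr; congr (_ - _).
rewrite -!mulrA [s j * (_ * _)]mulrA mul_saC mulNr -[a j * s j * e]mulrA.
rewrite mulrN [s i * (_ * _)]mulrA (mul_sa u) mulNr opprK -[a l * s i * _]mulrA.
by rewrite [s i * (_ * _)]mulrA mul_sse.
Qed.

Lemma mul_H_ae t i :
  H t * (a i * e) = (sgn k t * X t) *: (a (conj_transp t i) * e).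
Proof. by rewrite mul_Ha_l He -scalerAr scalerA. Qed.

Lemma mul_H_aae t i j : H t * (a i * a j * e) =
  X t *: (a (conj_transp t i) * a (conj_transp t j) * e).
Proof. by rewrite mulrA mul_Haa -!mulrA He -!scalerAr. Qed.

Lemma mul_H_aaae t i j l : H t * (a i * a j * a l * e) = (sgn k t * X t) *:
  (a (conj_transp t i) * a (conj_transp t j) * a (conj_transp t l) * e).
Proof.
by rewrite -!(mulrA (a i)) mul_Ha_l mul_H_aae -scalerAr scalerA !mulrA.
Qed.

(* The relation a_i a_j a_i - a_j a_i a_j = a_i - a_j makes this independent of
   the labelling of the three transpositions. *)
Definition top (i j l : transposition) := (a i * a j * a i - a i) * a l * e.

Lemma top_swap12 (i j l : transposition) : i != j -> top i j l = top j i l.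
Proof.
move=> /mul_aba /(canRL (subrK _)) E; congr (_ * _ * _); rewrite {}E.
by rewrite addrAC (addrAC _ (- a j)) subrr add0r addrC.
Qed.

Lemma topE (i j l : transposition) : uniq [:: i; j; l] ->
  top i j l = - (a i * a j * a l * a j * e) - a i * a l * e.
Proof.
move=> u; rewrite /top !mulrBl; congr (_ - _).
have /(congr1 (fun x => a i * x)) := mul_abce (uniq_swap23 (uniq_rot3 u)).
by rewrite mulrN !mulrA => <-.
Qed.

(** Expanding one side by [topE] and the other by [mul_abcbe] gives the same words. *)
Lemma top_swap23 (i j l : transposition) : uniq [:: i; j; l] ->
  top i j l = top i l j.
Proof.
move=> u; rewrite (topE u) /top !mulrBl (mul_abcbe u).
by rewrite [RHS]addrAC (addrAC (a i * a j * e)) subrr add0r addrC.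
Qed.

Lemma top_indep (i j l : transposition) :
  uniq [:: i; j; l] -> top i j l = top t12 t23 t13.
Proof.
have u1 : uniq [:: t12; t23; t13] by rewrite /= !inE !transp_neq.
have u2 := uniq_swap12 u1; have u3 := uniq_swap12 (uniq_swap23 u1).
have n x y z : uniq [:: x; y; z : transposition] -> x != y.
  by rewrite /= inE negb_or -andbA => /andP[].
(* The two exchanges generate all relabellings; [E1] to [E5] link the six of them. *)
have E1 := top_swap23 u1; have E2 := top_swap12 t13 (n _ _ _ u1).
have E3 := top_swap23 u2; have E4 := top_swap12 t23 (n _ _ _ (uniq_swap23 u1)).
have E5 := top_swap23 u3.
case: (transpositionP i) => ->; case: (transpositionP j) => ->;
  case: (transpositionP l) => ->; rewrite /= !inE ?eqxx ?transp_neq // => _.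
all: by rewrite -?E5 -?E4 -?E3 -?E2 -?E1.
Qed.

Local Notation u := (top t12 t23 t13).

(** Relabelling puts [m] first; then every term of [top] starts with [a m]. *)
Lemma mul_a_top m : a m * u = 0.
Proof.
have /transp_third[j ujm] : m != if m == t12 then t13 else t12.
  by case: ifPn => // /eqP ->; rewrite transp_neq.
rewrite -(top_indep ujm) /top !mulrA mulrBr !mulrA mul_aa !mul0r subrr !mul0r.
by [].
Qed.

(** The words in [top] have even length, so the signs cancel and [H t] merely conjugates the labels,
    which [top_indep] undoes. *)
Lemma mul_H_top t : H t * u = X t *: u.
Proof.
have u2 : uniq [seq conj_transp t x | x <- [:: t12; t23; t13]].
  by rewrite (map_inj_uniq (@conj_transp_inj t)) /= !inE !transp_neq.
rewrite -[in RHS](top_indep u2) /top !mulrBl -!mulrA mulrBr.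
do !rewrite mul_Ha_l -?scalerAr ?scalerA ?sgnK ?mul1r ?scale1r ?He ?scalerBr.
by rewrite -!scalerAr.
Qed.

Lemma mul_cabae (i j l : transposition) : uniq [:: i; j; l] ->
  a l * a i * a j * a i * e = - u - a l * a j * e.
Proof.
move=> ijl; have lij := uniq_rot3 (uniq_rot3 ijl).
by rewrite -(top_indep lij) (topE lij) opprD !opprK addrK.
Qed.

End Eigen.

(** * A span of words stable under all generators *)

Lemma lin_span_mul (G G' : B -> Prop) r x :
  (forall y, G y -> lin_span G' (r * y)) -> lin_span G x -> lin_span G' (r * x).
Proof.
move=> GG'; elim=> [|y /GG'//|c y z _ IHy _ IHz].
  by rewrite mulr0; exact: Span0.
by rewrite mulrDr -scalerAr; exact: SpanZD.
Qed.

Variant vacuum_word (e : B) : B -> Prop :=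
  | Word0 : vacuum_word e e
  | Word1 i : vacuum_word e (a i * e)
  | Word2 i j : vacuum_word e (a i * a j * e)
  | Word3 i j : i != j -> vacuum_word e (a i * a j * a i * e)
  | Word4 : vacuum_word e (top e t12 t23 t13).

Section Span.
Variables (chi : S3_char) (e : B).
Local Notation X := (char_val k chi).
Hypothesis He : forall t, H t * e = X t *: e.
Local Notation span := (lin_span (vacuum_word e)).
Local Notation u := (top e t12 t23 t13).

(** At length two, a third distinct letter is absorbed by [mul_abce]. At length three, [m] is the
    first letter (square zero), the second ([mul_abab]), or the remaining one, which produces [top]
    by [mul_cabae]. *)
Lemma span_mul_a m x : span x -> span (a m * x).
Proof.
apply: lin_span_mul => _ [|i|i j|i j ij|].
5: by rewrite (mul_a_top He); exact: Span0.
all: rewrite ?mulrA.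
- by apply/SpanG; constructor.
- by apply/SpanG; constructor.
- have [->|ij] := eqVneq i j.
    by rewrite -[_ * a j * a j]mulrA mul_aa mulr0 mul0r; exact: Span0.
  have [->|mi] := eqVneq m i; first by rewrite mul_aa !mul0r; exact: Span0.
  have [->|mj] := eqVneq m j.
    by apply/SpanG; constructor; rewrite eq_sym.
  have mij : uniq [:: m; i; j] by rewrite /= !inE (negPf mi) (negPf mj) ij.
  rewrite (mul_abce He mij); apply/lin_spanN/SpanG; exact: Word3.
- have [l ijl] := transp_third ij.
  case: (uniq_transp_cover m ijl) => ->.
  + by rewrite mul_aa !mul0r; exact: Span0.
  + rewrite mul_abab ?(eq_sym j) //; apply: SpanG; exact: Word2.
  + rewrite (mul_cabae He ijl).
    by apply: lin_spanD; apply: lin_spanN; apply: SpanG; constructor.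
Qed.

Lemma span_mul_H t x : span x -> span (H t * x).
Proof.
apply: lin_span_mul => _ [|i|i j|i j ij|].
- by rewrite He; apply/lin_spanZ/SpanG; constructor.
- by rewrite (mul_H_ae He); apply/lin_spanZ/SpanG; constructor.
- by rewrite (mul_H_aae He); apply/lin_spanZ/SpanG; constructor.
- rewrite (mul_H_aaae He); apply/lin_spanZ/SpanG; constructor.
  by rewrite (inj_eq (@conj_transp_inj t)).
- by rewrite (mul_H_top He); apply/lin_spanZ/SpanG; constructor.
Qed.

End Span.

(** * Compression by the idempotent of [chi] *)

Section Idempotent.
Variables (k_char0 : [pchar k] =i pred0) (chi : S3_char).
Local Notation X := (char_val k chi).

(** Since [0^-1 = 0], this element would vanish in characteristic 2 or 3, which [card_S3_neq0]
    excludes. *)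
Definition char_idem : B := (#|'S_3|%:R)^-1 *: \sum_t X t^-1 *: H t.
Local Notation e := char_idem.
Local Notation u := (top e t12 t23 t13).

Lemma natr_neq0 n : (n.+1%:R : k) != 0.
Proof. by have /pcharf0P-> := k_char0. Qed.

Lemma card_S3_neq0 : (#|'S_3|%:R : k) != 0.
Proof.
by have /pcharf0P-> := k_char0; rewrite -lt0n; apply/card_gt0P; exists 1%g.
Qed.

Lemma char_valMV t : X t^-1 * X t = 1.
Proof. by rewrite char_valM mulVg char_val1. Qed.

Lemma mul_H_idem t : H t * e = X t *: e.
Proof.
rewrite /e -scalerAr scalerA mulrC -scalerA; congr (_ *: _).
rewrite mulr_sumr scaler_sumr [RHS](reindex_inj (mulgI t)).
apply: eq_bigr => r _; rewrite -scalerAr (A1_rel_HM rels) scalerA.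
by rewrite invMg -char_valM mulrCA [X t * _]mulrC char_valMV mulr1.
Qed.

Lemma mul_idem_H t : e * H t = X t *: e.
Proof.
rewrite /e -scalerAl scalerA mulrC -scalerA; congr (_ *: _).
rewrite mulr_suml scaler_sumr [RHS](reindex_inj (mulIg t)).
apply: eq_bigr => r _; rewrite -scalerAl (A1_rel_HM rels) scalerA.
by rewrite invMg -char_valM mulrA [X t * _]mulrC char_valMV mul1r.
Qed.

Lemma mul_idem_eigen m : (forall t, H t * m = X t *: m) -> e * m = m.
Proof.
move=> Hm; rewrite /e -scalerAl mulr_suml.
under eq_bigr => t _ do rewrite -scalerAl Hm scalerA char_valMV scale1r.
by rewrite sumr_const -[m *+ _]scaler_nat scalerA mulVf ?card_S3_neq0 ?scale1r.
Qed.

(** The product [e * H t] also produces [X t], which cancels. Compression by [e] thus identifies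
    conjugate words up to the factor [c]. *)
Lemma proj_conj c t m m' : H t * m = (c * X t) *: m' -> e * m = c *: (e * m').
Proof.
move=> /(congr1 ( *%R e)); rewrite mulrA mul_idem_H -scalerAl -scalerAr.
move=> /(congr1 ( *:%R (X t^-1))).
by rewrite !scalerA mulrCA char_valMV mulr1 scale1r.
Qed.

Lemma scaler_natr_eq0 n (m : B) : m *+ n.+1 = 0 -> m = 0.
Proof.
by move=> /eqP; rewrite -scaler_nat scaler_eq0 (negPf (natr_neq0 n)) => /eqP.
Qed.

Lemma eq_opp_eq0 (m : B) : m = -1 *: m -> m = 0.
Proof.
move=> mN; apply: (@scaler_natr_eq0 1); rewrite mulr2n {1}mN.
by rewrite scaleN1r addNr.
Qed.

(** Conjugation by [i] fixes the label [i] but changes the sign, so the compression equals its own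
    negative. *)
Lemma proj_a i : e * (a i * e) = 0.
Proof.
apply/eq_opp_eq0/(@proj_conj _ (sval i)).
by rewrite (mul_H_ae mul_H_idem) sgn_transp conj_transp_self.
Qed.

Lemma proj_aa_conj t i j :
  e * (a i * a j * e) = e * (a (conj_transp t i) * a (conj_transp t j) * e).
Proof.
rewrite -[RHS]scale1r; apply: (@proj_conj _ t).
by rewrite (mul_H_aae mul_H_idem) mul1r.
Qed.

Lemma proj_aa i j : e * (a i * a j * e) = 0.
Proof.
have [->|/transp_third[l u]] := eqVneq i j; first by rewrite mul_aa mul0r mulr0.
(* Conjugating by [z] and then by [y] rotates the labels, so the three summands of [sum_aae] have
   the same compression, and three times it is zero. *)
have P x y z : uniq [:: x; y; z] -> e * (a x * a y * e) = e * (a y * a z * e).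
  move=> xyz; have zxy := uniq_rot3 (uniq_rot3 xyz).
  rewrite (proj_aa_conj (sval z)) (conj_transp_third zxy).
  rewrite (conj_transp_third (uniq_swap23 zxy)) (proj_aa_conj (sval y)).
  by rewrite conj_transp_self (conj_transp_third (uniq_swap12 xyz)).
apply: (@scaler_natr_eq0 2).
have := congr1 (fun x => e * x) (sum_aae mul_H_idem u).
by rewrite !mulrDr mulr0 -(P _ _ _ (uniq_rot3 u)) -(P _ _ _ u) mulrSr mulr2n.
Qed.

(** By [mul_aba] and [proj_a], exchanging [i] and [j] preserves the compression; conjugation by the
    third transposition makes the same exchange with a minus sign. *)
Lemma proj_aba i j : i != j -> e * (a i * a j * a i * e) = 0.
Proof.
move=> ij; have [l u] := transp_third ij; have u' := uniq_rot3 (uniq_rot3 u).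
apply: eq_opp_eq0; transitivity (e * (a j * a i * a j * e)).
  apply/eqP; rewrite -subr_eq0 -mulrBr -!mulrBl (mul_aba ij) mulrBl mulrBr.
  by rewrite !proj_a subrr.
apply: (@proj_conj _ (sval l)); rewrite (mul_H_aaae mul_H_idem) sgn_transp.
by rewrite (conj_transp_third u') (conj_transp_third (uniq_swap23 u')).
Qed.

Lemma proj_span x : lin_span (vacuum_word e) x ->
  exists c d, e * x = c *: e + d *: u.
Proof.
elim=> [|y [|i|i j|i j ij|]|r y z _ [c [d yE]] _ [c' [d' zE]]].
- by exists 0, 0; rewrite mulr0 !scale0r addr0.
- exists 1, 0; rewrite scale1r scale0r addr0 mul_idem_eigen //.
  exact: mul_H_idem.
- by exists 0, 0; rewrite proj_a !scale0r addr0.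
- by exists 0, 0; rewrite proj_aa !scale0r addr0.
- by exists 0, 0; rewrite proj_aba // !scale0r addr0.
- exists 0, 1; rewrite scale0r scale1r add0r mul_idem_eigen //.
  by apply: mul_H_top; exact: mul_H_idem.
exists (r * c + c'), (r * d + d').
rewrite mulrDr -scalerAr yE zE; set v := top _ _ _ _.
(* Here [w] stands for [e], itself a scaled sum; keeping it opaque leaves only the outer
   coefficients to the scaling laws. *)
have comb (w : B) : r *: (c *: w + d *: v) + (c' *: w + d' *: v) =
    (r * c + c') *: w + (r * d + d') *: v.
  by rewrite scalerDr !scalerA !scalerDl addrACA.
exact: comb.
Qed.

End Idempotent.
End Relations.

(** * The universal property of the induced module *)

Section IndLift.
Variables (R A : pzRingType) (f : {rmorphism R -> A}) (W : lmodType R).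
Variables (M : lmodType A) (psi : {linear W -> restrict f M}).

Fixpoint tens_eval (u : tens_term A W) : M :=
  match u with
  | TPure x w => x *: (psi w : M)
  | TZero => 0
  | TAdd u v => tens_eval u + tens_eval v
  | TOpp u => - tens_eval u
  end.

(** The case [tens_bal] is the linearity of [psi] over [R], which acts on [restrict f M] through
    [f]. *)
Lemma tens_eval_eq u v : tens_eq f u v -> tens_eval u = tens_eval v.
Proof.
elim=> {u v} //=.
- by move=> u v w _ -> _ ->.
- by move=> u u' v v' _ -> _ ->.
- by move=> u u' _ ->.
- by move=> u v w; rewrite addrA.
- by move=> u v; rewrite addrC.
- by move=> u; rewrite add0r.
- by move=> u; rewrite addNr.
- by move=> x y w; rewrite scalerDl.
- by move=> x w w'; rewrite linearD -scalerDr.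
- by move=> x r w; rewrite linearZ -scalerA.
Qed.

Definition ind_lift (x : induced f W) : M := tens_eval (repr x).

Lemma ind_liftE (u : classical (tens_term A W)) :
  ind_lift (\pi_(induced f W)%qT u) = tens_eval u.
Proof. by apply: tens_eval_eq; exact: tens_reprP. Qed.

Fact ind_lift_linear : linear ind_lift.
Proof.
move=> b; elim/ind_ind=> u; elim/ind_ind=> v.
rewrite [b *: _]ind_scaleE -ind_piD !ind_liftE /=; congr (_ + _).
elim: u => [x w||u IHu v' IHv|u IHu] /=.
- by rewrite scalerA.
- by rewrite scaler0.
- by rewrite IHu IHv scalerDr.
- by rewrite IHu scalerN.
Qed.
HB.instance Definition _ := GRing.isLinear.Build A (induced f W) M *:%R
  ind_lift ind_lift_linear.

Lemma ind_lift_tens x w : ind_lift (tens f x w) = x *: (psi w : M).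
Proof. exact: ind_liftE. Qed.

End IndLift.

(** * The induced module as a cyclic module on an eigenvector *)

Section Module.
Variables (k : fieldType) (chi : S3_char).
Local Notation X := (char_val k chi).
Local Notation A := (A1 k).

Section EigenLift.
Variables (M : lmodType A) (m : M).
Hypothesis Hm : forall t, A1_H k t *: m = ((X t)%:A : A) *: m.

Lemma kS3_eigen (r : group_algebra k 'S_3) :
  kS3_to_A1 k r *: m = ((kS3_char k chi r : k)%:A : A) *: m.
Proof.
rewrite /= /galg_lift !scaler_suml; apply: eq_bigr => t _.
rewrite -[_ *: A1_H k t]mulr_algl -[LHS]scalerA Hm [LHS]scalerA mulr_algl.
by rewrite scalerA.
Qed.

(** Frobenius reciprocity for a character: an eigenvector [m] gives a map out of [W_]. Scalars of
    [k] act on [M] through [%:A], and the eigenvector condition is an argument so that the linear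
    structure can depend on it. *)
Definition eigen_map of (forall t, A1_H k t *: m = ((X t)%:A : A) *: m) :=
  fun w : W_ k chi => ((w : k)%:A : A) *: m : restrict (kS3_to_A1 k) M.
Local Notation eigen := (eigen_map Hm).

Fact eigen_map_linear : linear eigen.
Proof.
move=> r w w'; rewrite /eigen_map.
have -> : ((r *: w + w' : W_ k chi) : k) =
    kS3_char k chi r * (w : k) + (w' : k) by [].
rewrite scalerDl scalerDl; congr (_ + _).
transitivity (((w : k)%:A : A) *: (kS3_to_A1 k r *: m)); last first.
  by rewrite scalerA mulr_algl -mulr_algr -scalerA.
by rewrite kS3_eigen scalerA mulr_algl scalerA mulrC.
Qed.
HB.instance Definition _ := GRing.isLinear.Build (group_algebra k 'S_3)
  (W_ k chi) (restrict (kS3_to_A1 k) M) *:%R eigen eigen_map_linear.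

Definition eigen_lift : {linear I_ k chi -> M} := ind_lift eigen.

End EigenLift.

Local Notation vac := (tens (kS3_to_A1 k) 1 (1 : W_ k chi)).

Lemma kS3_charZ c (r : group_algebra k 'S_3) :
  kS3_char k chi (c *: r) = c * kS3_char k chi r.
Proof. exact: linearZ. Qed.

Lemma kS3_to_A1Z c (r : group_algebra k 'S_3) :
  kS3_to_A1 k (c *: r) = c *: kS3_to_A1 k r.
Proof. exact: linearZ. Qed.

Lemma A1_charZ c (r : A) : A1_char k chi (c *: r) = c * A1_char k chi r.
Proof. exact: linearZ. Qed.

(** As [W_] is one-dimensional, [w] is a scalar times 1, and the scalar crosses the tensor sign. *)
Lemma tens_algr (r : A) (w : W_ k chi) :
  tens (kS3_to_A1 k) r w = (((w : k)%:A : A) * r) *: vac.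
Proof.
have wE : w = ((w : k) *: 1 : group_algebra k 'S_3) *: (1 : W_ k chi).
  transitivity (kS3_char k chi ((w : k) *: 1) * 1); last by [].
  by rewrite kS3_charZ rmorph1 !mulr1.
rewrite {1}wE -tens_balanced kS3_to_A1Z rmorph1 mulr_algr mulr_algl.
by rewrite tensZ mulr1.
Qed.

Lemma vac_gen (x : I_ k chi) : exists r : A, x = r *: vac.
Proof.
elim/ind_ind: x => u; elim: u => [r w||u [r ru] v [s sv]|u [r ru]].
- by eexists; exact: tens_algr.
- by exists 0; rewrite scale0r.
- by exists (r + s); rewrite ind_piD ru sv scalerDl.
- by exists (- r); rewrite ind_piN ru scaleNr.
Qed.

Lemma vac_eigen t : A1_H k t *: vac = ((X t)%:A : A) *: vac.
Proof.
have -> : A1_H k t = kS3_to_A1 k (galg_of k t) by rewrite /= galg_lift_of.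
rewrite tensZ mulr1 -[kS3_to_A1 k _]mul1r tens_balanced tens_algr mulr1.
suff -> : galg_of k t *: (1 : W_ k chi) = X t by [].
transitivity (kS3_char k chi (galg_of k t) * 1); first by [].
by rewrite mulr1 /= galg_lift_of.
Qed.

Lemma eigen_lift_vac (M : lmodType A) (m : M) Hm r :
  @eigen_lift M m Hm (r *: vac) = r *: m.
Proof.
by rewrite linearZ /= ind_lift_tens /= /eigen_map !scale1r.
Qed.

Lemma A1_span (e r : A) : (forall t, A1_H k t * e = X t *: e) ->
  lin_span (vacuum_word (@A1_a k) e) (r * e).
Proof.
move=> He; elim/A1_ind: r => u.
(* Stability of the whole span is the statement that passes through products in the induction on
   terms. *)
suff : forall x, lin_span (vacuum_word (@A1_a k) e) x ->
    lin_span (vacuum_word (@A1_a k) e) (\pi_(A1 k)%qT u * x).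
  by apply; apply/SpanG; exact: Word0.
elim: u => [c|t|i|u IHu v IHv|u IHu v IHv] x xs.
- rewrite (_ : _ * x = c *: x) //; exact: lin_spanZ.
- exact: (span_mul_H (A1_relsP k) He).
- exact: (span_mul_a (A1_relsP k) He).
- by rewrite A1_piD mulrDl; apply: lin_spanD; [exact: IHu|exact: IHv].
- by rewrite A1_piM -mulrA; apply/IHu/IHv.
Qed.

Hypothesis k_char0 : [pchar k] =i pred0.
Local Notation e := (char_idem (A1_H k) chi).
Local Notation u := (top (@A1_a k) e t12 t23 t13).

Lemma idem_eigen (M : lmodType A) (m : M) t :
  A1_H k t *: (e *: m) = ((X t)%:A : A) *: (e *: m).
Proof. by rewrite !scalerA (mul_H_idem (A1_relsP k)) mulr_algl. Qed.

Lemma idem_scale (M : lmodType A) (m : M) :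
  (forall t, A1_H k t *: m = ((X t)%:A : A) *: m) -> e *: m = m.
Proof.
move=> Hm; rewrite /char_idem -mulr_algl -scalerA scaler_suml.
have E t : (X t^-1 *: A1_H k t) *: m = m.
  rewrite -mulr_algl -scalerA Hm scalerA mulr_algl scalerA char_valMV.
  by rewrite !scale1r.
rewrite (eq_bigr _ (fun t _ => E t)) sumr_const -scaler_nat scalerA mulr_algl.
by rewrite -scalerMnr scalerMnl -mulr_natr mulVf ?card_S3_neq0 // !scale1r.
Qed.

(** Any preimage [m] of [h vac] becomes an eigenvector [e *: m], which [g] still sends to
    [e *: h vac = h vac]; agreement on the generator [vac] suffices. *)
Lemma I_projective : projective (I_ k chi).
Proof.
move=> M N g h gsurj; have [m gm] := gsurj (h vac).
exists (eigen_lift (idem_eigen m)) => x; have [r ->] := vac_gen x.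
have hE : h vac = e *: h vac by rewrite -{1}(idem_scale vac_eigen) linearZ.
by rewrite eigen_lift_vac !linearZ /= gm -hE.
Qed.

(** * The essential surjection onto the simple module *)

Lemma S_eigen t :
  A1_H k t *: (1 : S_ k chi) = ((X t)%:A : A) *: (1 : S_ k chi).
Proof.
rewrite ![_ *: _]/(A1_char k chi _ * _) A1_charZ rmorph1 /=.
by rewrite A1_lift_H !mulr1.
Qed.

Definition I_to_S : {linear I_ k chi -> S_ k chi} := eigen_lift S_eigen.

Lemma I_to_S_vac r : I_to_S (r *: vac) = A1_char k chi r.
Proof. by rewrite [LHS]eigen_lift_vac; exact: mulr1. Qed.

Lemma A1_char_idem : A1_char k chi e = 1.
Proof.
have := I_to_S_vac e; rewrite (idem_scale vac_eigen) => <-.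
by rewrite -[vac]scale1r I_to_S_vac rmorph1.
Qed.

Lemma A1_char_top : A1_char k chi u = 0.
Proof.
(* The character kills the factor [a t13] of [top]. *)
rewrite rmorphM rmorphM [X in _ * X * _](_ : _ = 0) ?mulr0 ?mul0r //.
exact: A1_lift_a.
Qed.

Lemma I_to_S_essential : essential I_to_S.
Proof.
move=> N [N0 NZD] [y yN] Nsurj; case/negP: yN.
have NZ r x : x \in N -> r *: x \in N.
  by move=> xN; rewrite -[_ *: _]addr0; exact: NZD.
have [x xN fx] := Nsurj 1; have [r xE] := vac_gen x.
have Hidem t := mul_H_idem (A1_relsP k) chi t.
have [c [d ereE]] := proj_span (A1_relsP k) k_char0 (A1_span r Hidem).
(* The character sends [e] to 1, [u] to 0, and [r] to the image of [x], which is 1. *)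
have c1 : c = 1.
  have := congr1 (A1_char k chi) ereE.
  rewrite (rmorphM _ e) (rmorphM _ r) A1_char_idem mulr1 mul1r.
  rewrite rmorphD (A1_charZ c) (A1_charZ d) A1_char_idem.
  by rewrite A1_char_top mulr0 addr0 mulr1 -I_to_S_vac -xE fx => ->.
pose p : A := (A1_a k t12 * A1_a k t23 * A1_a k t12 - A1_a k t12) * A1_a k t13.
have pu : p * u = 0.
  by rewrite -[p * u]mulrA (mul_a_top (A1_relsP k) Hidem) mulr0.
have inv : (1 - d *: p) * (e * (r * e)) = e.
  rewrite ereE c1 scale1r; have pe : p * e = u by [].
  move: p u e pu pe => q w v qw qv.
  rewrite mulrBl mul1r -scalerAl mulrDr -scalerAr qv qw scaler0 addr0.
  by rewrite addrK.
have [s ->] := vac_gen y.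
(* Since [e] fixes [vac], the vector [e *: x] is [(e * (r * e)) *: vac], and [inv] recovers the
   generator inside [N]. *)
have -> : vac = (1 - d *: p) *: (e *: x).
  transitivity (((1 - d *: p) * (e * (r * e))) *: vac).
    by rewrite inv (idem_scale vac_eigen).
  rewrite -[LHS]scalerA -[_ *: vac]scalerA xE -[(r * e) *: _]scalerA.
  by rewrite (idem_scale vac_eigen).
exact: (NZ _ _ (NZ _ _ (NZ _ _ xN))).
Qed.

End Module.

Theorem proposition5p14 (k : closedFieldType) (k_char0 : [pchar k] =i pred0)
    (chi : S3_char) :
  projective_cover (I_ k chi) (S_ k chi).
Proof.
split; first exact: I_projective.
exists (I_to_S k chi); split; last exact: I_to_S_essential.
move=> c; exists (((c : k)%:A : A1 k) *: tens (kS3_to_A1 k) 1 (1 : W_ k chi)).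
by rewrite I_to_S_vac A1_charZ rmorph1 mulr1.
Qed.
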